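(* Let $\mathcal{A}$ be a unital C*-algebra and let $\mathcal{A}^+ := \{a^*a : a \in \mathcal{A}\}$ be the set of all positive elements of $\mathcal{A}$. Let $d, n \in \mathbb{N}$ and let $\{\tau_j\}_{j=1}^n$ be a noncommutative $(d,n,\pi/3)$-spherical code in $\mathcal{A}^d$. Let $c \in (0,\infty)$ and let $\phi : \mathcal{A}^+ \to \mathbb{R}$ be a function satisfying the following: (i) $\sum_{1 \leq j,k \leq n} \phi(\langle \tau_j - \tau_k, \tau_j - \tau_k \rangle) \geq 0$; (ii) $\phi(a) + c \leq 0$ for all $a \in \mathcal{A}^+$ with $a \geq 1$. Then $$ n \leq \frac{\phi(0) + c}{c}. $$ In particular, if $\phi(0) + c \leq 1$, then $n \leq 1/c$.
   Context: $\mathbb{N} = \{1,2,3,\dots\}$. For a unital C*-algebra $\mathcal{A}$ and $d \in \mathbb{N}$, $\mathcal{A}^d$ denotes the standard left Hilbert C*-module with $\mathcal{A}$-valued inner product $\langle (a_j)_{j=1}^d, (b_j)_{j=1}^d \rangle := \sum_{j=1}^d a_j b_j^*$ and norm $\|(a_j)_{j=1}^d\| := \left\| \sum_{j=1}^d a_j a_j^* \right\|^{1/2}$. The order on self-adjoint elements is the usual C*-algebra order ($a \geq b$ iff $a - b \in \mathcal{A}^+$), and a real number $r$ is identified with $r \cdot 1 \in \mathcal{A}$. Definition: for $d \in \mathbb{N}$ and $\theta \in [0,2\pi)$, a collection $\{\tau_j\}_{j=1}^n$ of vectors in $\mathcal{A}^d$ is a noncommutative $(d,n,\theta)$-spherical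 code (or $(d,n,\theta)$-modular code) in $\mathcal{A}^d$ if (a) $\langle \tau_j, \tau_j \rangle = 1$ for all $1 \leq j \leq n$; and (b) $2 - \langle \tau_j, \tau_k \rangle - \langle \tau_k, \tau_j \rangle = \langle \tau_j - \tau_k, \tau_j - \tau_k \rangle \geq 2(1 - \cos\theta)$ in $\mathcal{A}$ for all $1 \leq j,k \leq n$ with $j \neq k$. The case $\theta = \pi/3$ is the noncommutative kissing number problem; there $2(1-\cos\theta) = 1$. *)

(* Defs.v *)
From HB Require Import structures.
From mathcomp Require Import all_boot all_order all_algebra.
From mathcomp Require Import all_classical all_reals all_analysis.
From mathcomp Require Import complex.

Set Implicit Arguments.
Unset Strict Implicit.
Unset Printing Implicit Defensive.

Import Order.TTheory GRing.Theory Num.Theory.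

Local Open Scope ring_scope.
Local Open Scope complex_scope.

(* A unital C*-algebra is a complex Banach space (norms take their values in
   R[i], where 0 <= z forces z to be real) with a unital associative bilinear
   submultiplicative product and a conjugate-linear anti-multiplicative
   involution satisfying the C*-identity. The product is a field of the mixin
   because Hierarchy Builder admits no join of normed modules with rings besides
   numDomainType. The axiom 1 <> 0 is not imposed. *)
HB.mixin Record isUnitalCStarAlgebra (R : realType) A
    of CompleteNormedModule R[i] A := {
  cone : A;
  cmul : A -> A -> A;
  star : A -> A;
  cmulA : associative cmul;
  cmul1l : left_id cone cmul;
  cmul1r : right_id cone cmul;
  cmulDl : left_distributive cmul +%R;
  cmulDr : right_distributive cmul +%R;
  cmulZl : forall (k : R[i]) (a b : A), cmul (k *: a) b = k *: cmul a b;
  cmulZr : forall (k : R[i]) (a b : A), cmul a (k *: b) = k *: cmul a b;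
  cmul_norm : forall a b : A, `|cmul a b| <= `|a| * `|b|;
  starK : involutive star;
  starD : {morph star : a b / a + b};
  starZ : forall (k : R[i]) (a : A), star (k *: a) = k^*%R *: star a;
  starM : forall a b : A, star (cmul a b) = cmul (star b) (star a);
  cstar_identity : forall a : A, `|cmul (star a) a| = `|a| ^+ 2
}.

#[short(type="unitalCStarAlgebraType")]
HB.structure Definition UnitalCStarAlgebra (R : realType) :=
  {A of CompleteNormedModule R[i] A & isUnitalCStarAlgebra R A}.

Definition cstar_pos (R : realType) (A : unitalCStarAlgebraType R) : set A :=
  [set x | exists a : A, x = cmul (star a) a].

Definition cstar_ge (R : realType) (A : unitalCStarAlgebraType R) (a b : A) :
  Prop := cstar_pos (a - b).

Definition cstar_real (R : realType) (A : unitalCStarAlgebraType R) (r : R) :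
  A := r%:C *: cone.

(* The A-valued inner product of the standard left Hilbert C*-module A^d,
   linear in its first argument. *)
Definition modinner (R : realType) (A : unitalCStarAlgebraType R) (d : nat)
  (a b : 'rV[A]_d) : A := \sum_(j < d) cmul (a 0 j) (star (b 0 j)).

Definition modular_code (R : realType) (A : unitalCStarAlgebraType R)
    (d n : nat) (theta : R) (tau : 'I_n -> 'rV[A]_d) : Prop :=
  [/\ 0 <= theta < 2 * pi,
      forall j, modinner (tau j) (tau j) = cone
    & forall j k, j != k ->
        cstar_ge (modinner (tau j - tau k) (tau j - tau k))
                 (cstar_real A (2 * (1 - cos theta)))].

(* Main.v *)
(* Splitting the double sum into diagonal and off-diagonal terms, (i) and (ii)
   give 0 <= n phi(0) - n (n - 1) c, hence the bound. Since (ii) covers only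
   elements of the form a^* a, one has to show that 1 + b^* b is of this form.

   This is done without spectral theory. Call a self-adjoint h positive when
   |t - h| <= t for some real t: such elements form a convex cone, and the
   iteration y <- (x + y^2) / 2, dominated by its scalar counterpart, gives each
   of them a positive square root, which commutes with whatever commutes with
   the element. If r and s are commuting self-adjoint elements with
   r^2 + s^2 = t, then r + i s is sqrt t times a unitary, so |r|^2 <= t; this
   shows that squares are positive and that 0 <= v <= t implies |v| <= t.
   Finally b^* b is positive: with h = b^* b, m = sqrt (h^2) and k = m - h, one
   has (b k)^* (b k) = - m k^2, and an element c with c^* c = - w^2, w
   self-adjoint, vanishes; then b k = 0, which forces k = 0. *)

Require Import Defs.
From HB Require Import structures.
From mathcomp Require Import all_boot all_order all_algebra.
From mathcomp Require Import all_classical all_reals all_analysis.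
From mathcomp Require Import complex ring lra.

Import Order.TTheory GRing.Theory Num.Theory numFieldNormedType.Exports.

Local Open Scope ring_scope.
Local Open Scope complex_scope.

(* The ring structure is put on a copy of A: Hierarchy Builder has no join of
   rings and normed modules. *)
Definition cstar_ring (R : realType) (A : unitalCStarAlgebraType R) : Type := A.

HB.instance Definition _ (R : realType) (A : unitalCStarAlgebraType R) :=
  GRing.Lmodule.copy (cstar_ring R A) A.

HB.instance Definition _ (R : realType) (A : unitalCStarAlgebraType R) :=
  GRing.Zmodule_isPzRing.Build (cstar_ring R A)
    (@cmulA R A) (@cmul1l R A) (@cmul1r R A) (@cmulDl R A) (@cmulDr R A).

Section CStarAlgebra.
Context {R : realType} {A : unitalCStarAlgebraType R}.
Local Notation B := (cstar_ring R A).
Local Notation cst t := (t%:C *: (1 : B)).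
Implicit Types (a b c h r s v w x y z : B) (t u : R) (k : R[i]).

(** * The real-valued norm and the involution *)

Definition adj a : B := star (a : A).
Definition nrm a : R := complex.Re `|a : A|.

Lemma nrmE a : `|a : A| = (nrm a)%:C.
Proof. by rewrite /nrm RRe_real// ger0_real. Qed.

Lemma nrm_ge0 a : 0 <= nrm a.
Proof. by rewrite -ler0c -nrmE. Qed.

Lemma nrm0_eq0 a : nrm a = 0 -> a = 0.
Proof. by move=> a0; apply: (@normr0_eq0 _ A); rewrite nrmE a0. Qed.

Lemma nrmD a b : nrm (a + b) <= nrm a + nrm b.
Proof. by rewrite -lecR rmorphD/= -!nrmE; exact: (@ler_normD _ A). Qed.

Lemma nrmM a b : nrm (a * b) <= nrm a * nrm b.
Proof. by rewrite -lecR rmorphM/= -!nrmE; exact: cmul_norm. Qed.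

Lemma nrmZ t a : nrm (t%:C *: a) = `|t| * nrm a.
Proof.
apply: complexI; rewrite rmorphM/= -!nrmE.
by rewrite [LHS](@normrZ _ A) normc_def/= expr0n addr0 sqrtr_sqr.
Qed.

Lemma nrmN a : nrm (- a) = nrm a.
Proof. by rewrite /nrm (@normrN _ A). Qed.

Lemma nrm0 : nrm (0 : B) = 0.
Proof. by rewrite /nrm (@normr0 _ A). Qed.

Lemma mulZl k a b : (k *: a) * b = k *: (a * b).
Proof. exact: cmulZl. Qed.

Lemma mulZr k a b : a * (k *: b) = k *: (a * b).
Proof. exact: cmulZr. Qed.

Lemma adjK a : adj (adj a) = a.
Proof. exact: starK. Qed.

Lemma adjD a b : adj (a + b) = adj a + adj b.
Proof. exact: starD. Qed.

Lemma adjM a b : adj (a * b) = adj b * adj a.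
Proof. exact: starM. Qed.

Lemma adjZ t a : adj (t%:C *: a) = t%:C *: adj a.
Proof. by rewrite [LHS]starZ conj_Creal// complex_real. Qed.

Lemma adjiZ a : adj ('i%C *: a) = - ('i%C *: adj a).
Proof.
rewrite [LHS]starZ -scaleNr; congr (_ *: _).
by apply/eqP; rewrite eq_complex/= oppr0 !eqxx.
Qed.

Lemma adj0 : adj 0 = 0.
Proof. by apply: (addrI (adj 0)); rewrite -adjD !addr0. Qed.

Lemma adjN a : adj (- a) = - adj a.
Proof.
by apply/eqP; rewrite -addr_eq0 -adjD addNr adj0.
Qed.

Lemma adjB a b : adj (a - b) = adj a - adj b.
Proof. by rewrite adjD adjN. Qed.

Lemma adj1 : adj 1 = 1 :> B.
Proof. by rewrite -[LHS]mulr1 -[X in _ * X]adjK -adjM mulr1 adjK. Qed.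

Lemma nrm_adjM a : nrm (adj a * a) = nrm a ^+ 2.
Proof.
by apply: complexI; rewrite rmorphXn/= -!nrmE; exact: cstar_identity.
Qed.

(** The C*-identity gives |b|^2 <= |adj b| |b|; cancel |b|, then exchange [b] and [adj b]. *)
Lemma nrm_adj a : nrm (adj a) = nrm a.
Proof.
suff le_adj b : nrm b <= nrm (adj b).
  by apply/eqP; rewrite eq_le le_adj -{2}(adjK a) le_adj.
have [->|b0] := eqVneq (nrm b) 0; first exact: nrm_ge0.
have bgt0 : 0 < nrm b by rewrite lt0r b0 nrm_ge0.
by rewrite -(ler_pM2r bgt0) -expr2 -nrm_adjM nrmM.
Qed.

Lemma nrm_sqr a : adj a = a -> nrm (a * a) = nrm a ^+ 2.
Proof. by move=> {1}<-; exact: nrm_adjM. Qed.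

(** The norm of 1 equals its own square; in the zero algebra it is 0, hence only an inequality. *)
Lemma nrm1_le1 : nrm (1 : B) <= 1.
Proof.
rewrite leNgt; apply/negP => n1.
have := nrm_sqr 1 adj1; rewrite mulr1 => e; nra.
Qed.

Lemma nrmZ1 t : 0 <= t -> nrm (cst t) <= t.
Proof.
by move=> t0; rewrite nrmZ ger0_norm// ler_piMr// nrm1_le1.
Qed.

(** * Limits of dominated iterations, and square roots near 1 *)

Lemma sum_cvg (y : nat -> B) (s : nat -> R) :
    (forall n, s n <= 1) -> (forall n, nrm (y n.+1 - y n) <= s n.+1 - s n) ->
  exists l : B, (nrm (l - y n) @[n --> \oo] --> (0 : R))%classic.
Proof.
move=> s1 ys.
(* By telescoping, [y] inherits the Cauchy property from the monotone bounded [s]. *)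
have step m n : (n <= m)%N -> nrm (y m - y n) <= s m - s n.
  move=> /subnK <-; elim: (m - n)%N => [|j IH].
    by rewrite add0n !subrr nrm0.
  rewrite addSn -(subrKA (y (j + n)%N)) -[leRHS](subrKA (s (j + n)%N)).
  by rewrite (le_trans (nrmD _ _))// lerD.
have s_ndecr : {homo s : n m / (n <= m)%N >-> n <= m}.
  by move=> n m /step h; rewrite -subr_ge0 (le_trans (nrm_ge0 _) h).
have s_cvg : cvgn s.
  by apply: nondecreasing_is_cvgn => //; exists 1 => _ [n _ <-].
have y_cvg : cvg ((y : nat -> A) @ \oo)%classic.
  apply/cauchy_cvgP/cauchy_exP => e e0.
  have eE : e = (complex.Re e)%:C by rewrite RRe_real// gtr0_real.
  have e0' : 0 < complex.Re e by rewrite -ltcR -eE.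
  have /cvgrPdist_lt/(_ _ e0') [N _ sN] := s_cvg.
  exists (y N : A), N => // m /= Nm.
  rewrite -ball_normE/= distrC nrmE eE ltcR.
  apply: le_lt_trans (step _ _ Nm) _; apply: le_lt_trans (sN N (leqnn N)).
  by rewrite (le_trans _ (ler_norm _))// lerB// nondecreasing_cvgn_le.
exists (limn (y : nat -> A)); apply/cvgrPdist_le => e e0.
have /cvgrPdist_le/(_ e%:C) := y_cvg.
rewrite ltcR => /(_ e0); apply: filterS => n.
by rewrite sub0r normrN ger0_norm ?nrm_ge0// -lecR -nrmE.
Qed.

(** Carries estimates on iterates to their limit; two consecutive terms occur because the recursion
    links [y n.+1] to [y n]. *)
Lemma cvg0_le0 (u_ : nat -> R) (K L t : R) :
  (u_ n @[n --> \oo] --> (0 : R))%classic ->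
  (forall n, t <= K * u_ n + L * u_ n.+1) -> t <= 0.
Proof.
move=> u0 tle.
have : (K * u_ n + L * u_ n.+1 @[n --> \oo] --> K * 0 + L * 0)%classic.
  by apply: cvgD; apply: cvgMl_tmp => //; rewrite cvg_shiftS.
rewrite !mulr0 addr0 => lim0.
by apply: cvgr_to_ge lim0 _; apply: nearW.
Qed.

Lemma mulr_subr_sqr a b : a * a - b * b = (a - b) * a + b * (a - b).
Proof. by rewrite mulrBl mulrBr subrKA. Qed.

(** For r = 1 - l the equation r^2 = 1 - x reads l = (x + l^2) / 2, a fixed point reached by
    iterating from 0. *)
Lemma sqrt_1B x : adj x = x -> nrm x <= 1 ->
  exists r, [/\ adj r = r, r * r = 1 - x, nrm (1 - r) <= 1
                & forall z, x * z = z * x -> r * z = z * r].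
Proof.
move=> xsa x1.
have nrmh a : nrm (2^-1%:C *: a) = 2^-1 * nrm a by rewrite nrmZ ger0_norm.
pose y := fix y n := if n is m.+1 then 2^-1%:C *: (x + y m * y m) else 0.
(* The scalar iteration for x = 1: it stays in [0, 1] and dominates [y] and its increments. *)
pose s := fix s n := if n is m.+1 then 2^-1 * (1 + s m * s m) else 0 : R.
have s01 n : 0 <= s n <= 1 by elim: n => [|n /andP[]] /=; nra.
have ys n : nrm (y n) <= s n.
  elim: n => [|n IH] /=; first by rewrite nrm0.
  rewrite nrmh ler_pM2l// (le_trans (nrmD _ _))// lerD//.
  rewrite (le_trans (nrmM _ _))//.
  by rewrite ler_pM ?nrm_ge0.
have dys n : nrm (y n.+1 - y n) <= s n.+1 - s n.
  elim: n => [|n IH]; first by have := ys 1%N; rewrite /= !subr0.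
  have -> : y n.+2 - y n.+1
      = 2^-1%:C *: ((y n.+1 - y n) * y n.+1 + y n * (y n.+1 - y n)).
    by rewrite [LHS]/= -scalerBr -mulr_subr_sqr opprD addrACA subrr add0r.
  have -> : s n.+2 - s n.+1
      = 2^-1 * ((s n.+1 - s n) * s n.+1 + s n * (s n.+1 - s n)).
    by rewrite /=; ring.
  rewrite nrmh ler_pM2l// (le_trans (nrmD _ _))//.
  by apply: lerD; rewrite (le_trans (nrmM _ _))// ler_pM ?nrm_ge0.
have [l lim_y] := sum_cvg y s (fun n => proj2 (andP (s01 n))) dys.
have y1 n : nrm (y n) <= 1 by rewrite (le_trans (ys n))//; case/andP: (s01 n).
(* Each identity for [l] below follows by bounding its defect by distances to the iterates. *)
have eq0 (K L : R) a :
    (forall n, nrm a <= K * nrm (l - y n) + L * nrm (l - y n.+1)) -> a = 0.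
  move=> /(cvg0_le0 _ _ _ _ lim_y) a0; apply: nrm0_eq0.
  by apply/eqP; rewrite eq_le a0 nrm_ge0.
have lsa : adj l = l.
  apply/eqP; rewrite -subr_eq0; apply/eqP/(eq0 2 0) => n.
  have ysa : adj (y n) = y n.
    by elim: n => [|n IH] /=; rewrite ?adj0// adjZ adjD adjM IH xsa.
  have -> : adj l - l = adj (l - y n) - (l - y n).
    by rewrite adjB ysa opprB addrA subrK.
  by rewrite mul0r addr0 mulr_natl mulr2n (le_trans (nrmD _ _))// nrmN nrm_adj.
have l1 : nrm l <= 1.
  rewrite -subr_le0; apply: (cvg0_le0 _ 1 0 _ lim_y) => n.
  rewrite mul1r mul0r addr0 lerBlDr -{1}(subrK (y n) l).
  by rewrite (le_trans (nrmD _ _))// lerD.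
have lE : l + l = x + l * l.
  have /eqP : l - 2^-1%:C *: (x + l * l) = 0.
    apply: (eq0 1 1) => n.
    have -> : l - 2^-1%:C *: (x + l * l) = (l - y n.+1)
        - 2^-1%:C *: ((l - y n) * l + y n * (l - y n)).
      rewrite -mulr_subr_sqr [y n.+1]/=.
      by rewrite -addrA -opprD -scalerDr -addrA (addrC (y n * _)) subrK.
    rewrite (le_trans (nrmD _ _))// nrmN nrmh addrC !mul1r lerD2r.
    rewrite ler_pdivrMl// mulr_natl mulr2n (le_trans (nrmD _ _))//.
    by apply: lerD; rewrite (le_trans (nrmM _ _))//;
      rewrite ?ler_piMr ?ler_piMl ?nrm_ge0.
  rewrite subr_eq0 => /eqP lE; rewrite {1 2}lE -scalerDl -rmorphD/=.
  have -> : 2^-1 + 2^-1 = 1 :> R by lra.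
  by rewrite scale1r.
have lcomm z : x * z = z * x -> l * z = z * l.
  move=> xz; apply/eqP; rewrite -subr_eq0.
  apply/eqP/(eq0 (nrm z + nrm z) 0) => n.
  have yz : y n * z = z * y n.
    elim: n => [|n IH] /=; first by rewrite mulr0 mul0r.
    by rewrite mulZl mulZr mulrDl mulrDr xz -mulrA IH mulrA IH mulrA.
  have -> : l * z - z * l = (l - y n) * z - z * (l - y n).
    by rewrite mulrBl mulrBr yz opprB addrA subrK.
  rewrite mul0r addr0 [leRHS]mulrDl (le_trans (nrmD _ _))// nrmN.
  rewrite lerD// (le_trans (nrmM _ _))//.
  by rewrite mulrC.
exists (1 - l); split.
- by rewrite adjB adj1 lsa.
- have -> : x = l + l - l * l by rewrite lE addrK.
  rewrite mulrBr mulr1 mulrBl mul1r !opprB -addrA; congr (_ + _).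
  by rewrite addrCA -opprD.
- by rewrite opprB addrC subrK.
- by move=> z /lcomm lz; rewrite mulrBl mulrBr lz mul1r mulr1.
Qed.

(** * Positive elements, their square roots and norm bounds *)

Lemma scaleii a : 'i%C *: ('i%C *: a) = - a.
Proof. by rewrite scalerA -expr2 sqr_i scaleN1r. Qed.

(** The bound puts the spectrum of [h] in [0, 2t]: this is the usual positivity, phrased so that
    sums reduce to the triangle inequality. *)
Definition cpos h := adj h = h /\ exists t, nrm (cst t - h) <= t.

Lemma adj_cst t : adj (cst t) = cst t.
Proof. by rewrite adjZ adj1. Qed.

Lemma mul_cst t a : cst t * a = t%:C *: a.
Proof. by rewrite mulZl mul1r. Qed.

Lemma mulr_cst t a : a * cst t = t%:C *: a.
Proof. by rewrite mulZr mulr1. Qed.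

Lemma cposD a b : cpos a -> cpos b -> cpos (a + b).
Proof.
move=> [asa [t at_]] [bsa [u bu]]; split; first by rewrite adjD asa bsa.
exists (t + u); rewrite rmorphD/= scalerDl opprD addrACA.
by rewrite (le_trans (nrmD _ _))// lerD.
Qed.

Lemma cposZ t a : 0 <= t -> cpos a -> cpos (t%:C *: a).
Proof.
move=> t0 [asa [u au]]; split; first by rewrite adjZ asa.
exists (t * u); rewrite rmorphM/= -scalerA -scalerBr nrmZ ger0_norm//.
by rewrite ler_wpM2l.
Qed.

Lemma cpos1 : cpos 1.
Proof. by split; [exact: adj1 | exists 1; rewrite scale1r subrr nrm0]. Qed.

(** For t > 0, x = (t - h) / t has norm at most 1 and h = t (1 - x), so [sqrt_1B] applies; its bound
    |1 - r| <= 1 makes the root positive. *)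
Lemma cpos_sqrt h : cpos h ->
  exists r, [/\ cpos r, r * r = h & forall z, h * z = z * h -> r * z = z * r].
Proof.
move=> [hsa [t ht]]; have := le_trans (nrm_ge0 _) ht; rewrite le_eqVlt.
case/predU1P => [t0|tgt0].
  exists 0; rewrite mulr0; split=> [||z]; last by rewrite mul0r mulr0.
    by split; [exact: adj0 | exists 0; rewrite scale0r subrr nrm0].
  apply/esym/nrm0_eq0/eqP; rewrite eq_le nrm_ge0 andbT.
  by move: ht; rewrite -t0 scale0r sub0r nrmN.
have x1 : nrm (t^-1%:C *: (cst t - h)) <= 1.
  by rewrite nrmZ gtr0_norm ?invr_gt0// ler_pdivrMl// mulr1.
have [|r [rsa rE r1 rcomm]] := sqrt_1B _ _ x1.
  by rewrite adjZ adjB adj_cst hsa.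
exists ((Num.sqrt t)%:C *: r); split.
- split; first by rewrite adjZ rsa.
  exists (Num.sqrt t); rewrite -scalerBr nrmZ ger0_norm ?sqrtr_ge0//.
  by rewrite ler_piMr ?sqrtr_ge0.
- rewrite mulZl mulZr scalerA -rmorphM/= -expr2 sqr_sqrtr ?ltW// rE.
  rewrite scalerBr scalerA -rmorphM/= mulfV ?gt_eqF// scale1r.
  by rewrite opprB addrC subrK.
- move=> z hz; rewrite mulZl mulZr rcomm// mulZl mulZr mulrBl mulrBr hz.
  by rewrite mul_cst mulr_cst.
Qed.

(** Commutation gives [adj v * v = cst t] for v = r + i s, and r is the mean of [v] and [adj v]. *)
Lemma nrm_sqr_le r s t : adj r = r -> adj s = s -> r * s = s * r ->
  0 <= t -> r * r + s * s = cst t -> nrm r ^+ 2 <= t.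
Proof.
move=> rsa ssa rs t0 rst; pose v := r + 'i%C *: s.
have vv : adj v * v = cst t.
  rewrite adjD adjiZ rsa ssa mulrDr !mulrBl !mulZl !mulZr scaleii.
  by rewrite opprK rs addrA subrK.
have vt : nrm v ^+ 2 <= t by rewrite -nrm_adjM vv nrmZ1.
apply: le_trans vt; rewrite ler_pXn2r ?nnegrE ?nrm_ge0//.
rewrite -(ler_pM2l (@ltr0n R 2)) -[X in X * nrm r]ger0_norm// -nrmZ.
have -> : 2%:C *: r = v + adj v.
  rewrite adjD adjiZ rsa ssa addrACA subrr addr0.
  by rewrite rmorphD rmorph1 scalerDl scale1r.
by rewrite (le_trans (nrmD _ _))// nrm_adj mulr_natl mulr2n.
Qed.

(** The element t - h^2 has a root s commuting with h; now s^2 + h^2 = t bounds |s|^2 = |t -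
    h^2|. *)
Lemma nrm_cst_sub_sqr h t : adj h = h -> nrm h ^+ 2 <= t ->
  nrm (cst t - h * h) <= t.
Proof.
move=> hsa ht; have t0 : 0 <= t by rewrite (le_trans _ ht)// sqr_ge0.
have [|s [[ssa _] sE scomm]] := cpos_sqrt (cst t - h * h).
  split; first by rewrite adjB adj_cst adjM hsa.
  by exists t; rewrite opprB addrC subrK nrm_sqr.
rewrite -sE nrm_sqr//; apply: (nrm_sqr_le s h) => //.
  by apply: scomm; rewrite mulrBl mulrBr mul_cst mulr_cst mulrA.
by rewrite sE subrK.
Qed.

Lemma cpos_sqr h : adj h = h -> cpos (h * h).
Proof.
move=> hsa; split; first by rewrite adjM hsa.
by exists (nrm h ^+ 2); apply: nrm_cst_sub_sqr.
Qed.

(** The roots of v and t - v commute and their squares add up to t. *)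
Lemma nrm_le_cst v t : 0 <= t -> cpos v -> cpos (cst t - v) -> nrm v <= t.
Proof.
move=> t0 /cpos_sqrt[r [[rsa _] rE rcomm]] /cpos_sqrt[s [[ssa _] sE scomm]].
rewrite -rE nrm_sqr//; apply: (nrm_sqr_le r s) => //.
  apply/esym/scomm; rewrite mulrBl mulrBr mul_cst mulr_cst.
  by rewrite rcomm.
by rewrite rE sE addrC subrK.
Qed.

(** * Positivity of [adj b * b] *)

(* With d = adj c: (c + d)^2 + (i (c - d))^2 = 2 (c d + d c). *)
Lemma cpos_adjr c w : adj w = w -> adj c * c = - (w * w) -> cpos (c * adj c).
Proof.
move=> wsa cw.
have half a : 2^-1%:C *: (a + a) = a.
  rewrite -[a]scale1r -scalerDl scalerA -(rmorph1 (real_complex R)) -rmorphD.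
  by rewrite -rmorphM/=; congr (_%:C *: _); lra.
have E : (c + adj c) * (c + adj c)
      + ('i%C *: (c - adj c)) * ('i%C *: (c - adj c))
    = (c * adj c + adj c * c) + (c * adj c + adj c * c).
  rewrite mulZl mulZr scaleii.
  rewrite mulr_subr_sqr.
  have -> : c + adj c - (c - adj c) = adj c + adj c.
    by rewrite opprB addrC addrA subrK.
  have e : adj c * (c + adj c) + (c - adj c) * adj c = c * adj c + adj c * c.
    by rewrite mulrDr mulrBl addrACA subrr addr0 addrC.
  by rewrite mulrDl (mulrDr (c - _)) addrACA e.
(* The term [w * w] cancels [adj c * c], leaving squares of self-adjoint elements. *)
have -> : c * adj c = w * w + 2^-1%:C *: ((c + adj c) * (c + adj c)
    + ('i%C *: (c - adj c)) * ('i%C *: (c - adj c))).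
  by rewrite E half cw addrC subrK.
apply: cposD; first exact: cpos_sqr.
apply: cposZ; first by [].
apply: cposD; apply: cpos_sqr; first by rewrite adjD adjK addrC.
by rewrite adjiZ adjB adjK -scalerN opprB.
Qed.

(** Classically, [adj c * c] and [c * adj c] share their nonzero spectrum; here a norm estimate
    based on positivity of [c * adj c] takes over. *)
Lemma adjM_opp_sqr_eq0 c w : adj w = w -> adj c * c = - (w * w) -> c = 0.
Proof.
move=> wsa cw; pose v := w * w; pose t := nrm c ^+ 2.
have vsa : adj v = v by rewrite adjM wsa.
have nv : nrm v = t by rewrite -nrmN -cw nrm_adjM.
have t0 : 0 <= t by exact: sqr_ge0.
have cc_t : nrm (cst t - c * adj c) <= t.
  have [r [[rsa _] rE _]] := cpos_sqrt _ (cpos_adjr c w wsa cw).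
  rewrite -rE; apply: nrm_cst_sub_sqr => //.
  by rewrite -nrm_sqr// rE -{1}(adjK c) nrm_adjM nrm_adj.
(* Conjugating [cst t - c * adj c] by [c] trades [c * adj c] for [adj c * c];
   completing the square then forces [nrm v <= 5/8 nrm v]. *)
have vle : nrm (t%:C *: v + v * v) <= t * t.
  have -> : t%:C *: v + v * v = - (adj c * (cst t - c * adj c) * c).
    rewrite mulrBr mulrBl mulr_cst mulZl (mulrA (adj c)).
    by rewrite -(mulrA (adj c * c)) !cw mulrNN scalerN opprD !opprK.
  rewrite nrmN (le_trans (nrmM _ _))//.
  have tE : t * t = (nrm c * t) * nrm c by rewrite /t; ring.
  rewrite tE ler_wpM2r ?nrm_ge0// (le_trans (nrmM _ _))// nrm_adj.
  by rewrite ler_wpM2l ?nrm_ge0.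
(* The constant 9/8 is a rational upper bound for sqrt 5 / 2. *)
have v2 : nrm (v + cst (t / 2)) <= 9 / 8 * t.
  have sa : adj (v + cst (t / 2)) = v + cst (t / 2) by rewrite adjD adj_cst vsa.
  have : nrm (v + cst (t / 2)) ^+ 2 <= t * t + t / 2 * (t / 2).
    rewrite -nrm_sqr//.
    have -> : (v + cst (t / 2)) * (v + cst (t / 2))
        = (t%:C *: v + v * v) + cst (t / 2 * (t / 2)).
      rewrite mulrDl !mulrDr mul_cst mulr_cst mulr_cst scalerA -rmorphM/= addrA.
      congr (_ + _); rewrite -addrA -scalerDl -rmorphD/= addrC.
      by congr (_%:C *: _ + _); lra.
    by rewrite (le_trans (nrmD _ _))// lerD// nrmZ1// mulr_ge0// divr_ge0.
  have := nrm_ge0 (v + cst (t / 2)); move: (nrm (v + _)) => X X0 X2.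
  have t98 : 0 <= 9 / 8 * t by lra.
  by rewrite -(@ler_pXn2r _ 2)// (le_trans X2)//; have := sqr_ge0 t; lra.
have : nrm v <= 5 / 8 * t.
  apply: nrm_le_cst; [lra | exact: cpos_sqr | split].
    by rewrite adjB adj_cst vsa.
  (* Here 5/8 = 9/8 - 1/2; what matters is that it is below 1. *)
  exists (9 / 8 * t); rewrite opprB addrCA -scalerBl -rmorphB/=.
  by rewrite (_ : 9 / 8 * t - 5 / 8 * t = t / 2)//; lra.
rewrite nv => tle; apply/nrm0_eq0/eqP.
by rewrite -sqrf_eq0 -/t eq_le t0 andbT; lra.
Qed.

Lemma cpos_adjM b : cpos (adj b * b).
Proof.
pose h := adj b * b; rewrite -/h.
have hsa : adj h = h by rewrite adjM adjK.
have [m [mpos mE mcomm]] := cpos_sqrt _ (cpos_sqr _ hsa).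
have msa := proj1 mpos.
have mh : m * h = h * m by apply: mcomm; rewrite mulrA.
(* Since m = |h|, this is twice the negative part of h. *)
pose k := m - h.
have ksa : adj k = k by rewrite adjB msa hsa.
have mk : m * k = k * m by rewrite mulrBl mulrBr mh.
have hk : h * k = - (m * k) by rewrite !mulrBr mE mh opprB.
(* The root of m displays m k^2 as the square of the self-adjoint [q * k]. *)
have [q [[qsa _] qE qcomm]] := cpos_sqrt _ mpos.
have qk : q * k = k * q by exact: qcomm.
have bk0 : b * k = 0.
  apply: (adjM_opp_sqr_eq0 _ (q * k)); first by rewrite adjM ksa qsa.
  rewrite adjM ksa mulrA -(mulrA k) -mulrA hk mulrN; congr (- _).
  by rewrite {1}qk -!mulrA; congr (_ * _); rewrite mulrA qE.
have hk0 : h * k = 0 by rewrite -mulrA bk0 mulr0.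
have mk0 : m * k = 0 by apply/eqP; rewrite -oppr_eq0 -hk hk0.
have k0 : k = 0.
  apply/nrm0_eq0/eqP; rewrite -sqrf_eq0 -nrm_sqr//.
  by rewrite {1}/k mulrBl hk0 mk0 subrr nrm0.
by have <- : m = h by apply/eqP; rewrite -subr_eq0 -/k k0.
Qed.

Lemma cstar_pos_add1 b : exists r, 1 + adj b * b = adj r * r.
Proof.
have [r [[rsa _] rE _]] := cpos_sqrt _ (cposD _ _ cpos1 (cpos_adjM b)).
by exists r; rewrite rsa rE.
Qed.

End CStarAlgebra.

(** * The bound for codes of angle pi/3 *)

Lemma cstar_ge1_pos (R : realType) (A : unitalCStarAlgebraType R) (a : A) :
  cstar_ge a cone -> cstar_pos a.
Proof.
move=> [b ab]; have [r rE] := cstar_pos_add1 (b : cstar_ring R A).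
by exists r; rewrite -[RHS]rE -(subrK cone a) ab addrC.
Qed.

(** The triple-angle formula at pi gives 4x^3 - 3x + 1 = (x + 1)(2x - 1)^2 = 0, and x > 0. *)
Lemma cos_pi3 (R : realType) : cos (pi / 3 : R) = 2^-1.
Proof.
have pi_gt0 := pi_gt0 R.
have cgt0 : 0 < cos (pi / 3 : R) by apply: cos_gt0_pihalf; lra.
have := cosD (pi / 3 + pi / 3) (pi / 3 : R).
have -> : pi / 3 + pi / 3 + pi / 3 = pi :> R by field.
rewrite cospi cosD sinD => cE; have s2 := cos2Dsin2 (pi / 3 : R).
have : (cos (pi / 3 : R) + 1) * (2 * cos (pi / 3) - 1) ^+ 2 = 0.
  move: cE s2; set x := cos _; set y := sin _ => cE s2.
  have y2 : y ^+ 2 = 1 - x ^+ 2 by lra.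
  have : -1 = x ^+ 3 - 3 * x * y ^+ 2 by rewrite cE; ring.
  by rewrite y2; lra.
by move=> /eqP; rewrite mulf_eq0 sqrf_eq0 gt_eqF//= ?ltr_wpDr// => /eqP; lra.
Qed.

Lemma modinner0 (R : realType) (A : unitalCStarAlgebraType R) (d : nat)
  (b : 'rV[A]_d) : modinner 0 b = 0.
Proof.
by apply: big1 => j _; rewrite mxE; exact: (@mul0r (cstar_ring R A)).
Qed.

Theorem corollary2p5 (R : realType) (A : unitalCStarAlgebraType R)
  (d n : nat) (d_gt0 : (0 < d)%N) (n_gt0 : (0 < n)%N)
  (tau : 'I_n -> 'rV[A]_d) (tau_code : modular_code (pi / 3) tau)
  (c : R) (c_gt0 : 0 < c) (phi : A -> R)
  (phi_sum_ge0 :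
     0 <= \sum_(j < n) \sum_(k < n)
            phi (modinner (tau j - tau k) (tau j - tau k)))
  (phi_le : forall a : A, cstar_pos a -> cstar_ge a cone -> phi a + c <= 0) :
  n%:R <= (phi 0 + c) / c /\ (phi 0 + c <= 1 -> n%:R <= 1 / c).
Proof.
have [_ _ far] := tau_code.
have off j k : j != k ->
    phi (modinner (tau j - tau k) (tau j - tau k)) <= - c.
  move=> /far; have -> : cstar_real A (2 * (1 - cos (pi / 3))) = cone.
    by rewrite /cstar_real cos_pi3 (_ : 2 * _ = 1) ?scale1r//; lra.
  by move=> ge1; rewrite -subr_le0 opprK phi_le//; exact: cstar_ge1_pos.
have row_le (j : 'I_n) :
    \sum_(k < n) phi (modinner (tau j - tau k) (tau j - tau k))
      <= phi 0 - c * n.-1%:R.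
  rewrite (bigD1 j)//= subrr modinner0 lerD2l -mulNr mulr_natr.
  rewrite -[n in n.-1]card_ord -(cardC1 j) -sumr_const.
  by apply: ler_sum => k kj; apply: off; rewrite eq_sym.
have n_gt0' : 0 < n%:R :> R by rewrite ltr0n.
have : 0 <= (phi 0 - c * n.-1%:R) * n%:R.
  rewrite (le_trans phi_sum_ge0)//.
  rewrite (le_trans (ler_sum _ (fun j _ => row_le j)))//.
  by rewrite sumr_const card_ord [leRHS]mulr_natr.
rewrite pmulr_lge0// => phi0_ge.
(* The predecessor is truncated, so [n_gt0] enters here. *)
have nE : n%:R = n.-1%:R + 1 :> R by rewrite natr1 prednK.
have n_le : n%:R * c <= phi 0 + c by rewrite nE; lra.
split=> [|phi0_le]; rewrite ler_pdivlMr//; exact: le_trans n_le phi0_le.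
Qed.
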